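(* Let $n\ge 1$ and let $L=\sum_{i=1}^k c_i(1+t)^{n_i}H_i\in\mathbb{G}[t]$, where each $H_i$ is a graph with vertex set $[n]$, be written in Tutte standard form. Then $L$ is a modular relation for $XB$ if and only if for every set partition $\pi$ of $[n]$ we have $$B(L;\pi):=\sum_{i=1}^k c_i(1+t)^{n_i+e_{H_i}(\pi)}=0 ,$$ where $e_{H_i}(\pi)$ is the number of edges of $H_i$ (counted with multiplicity) with both endpoints in the same block of $\pi$.
   Context: Write $[n]=\{1,\dots,n\}$. A graph is a finite vertex set $V(G)$ together with a finite multiset $E(G)$ of unordered pairs of not necessarily distinct vertices (loops and multi-edges are allowed). $\mathbb{G}$ is the $\mathbb{C}$-vector space freely generated by all (labelled) graphs whose vertex set is $[n]$ for some $n\ge 1$; $\mathbb{G}[t]$ consists of formal linear combinations of such graphs with coefficients in $\mathbb{C}[t]$. Tutte standard form: $L\in\mathbb{G}[t]$ is written in Tutte standard form when it is written as $L=\sum_{i=1}^k c_i(1+t)^{n_i}H_i$ with $c_i\in\mathbb{C}$, $n_i$ a nonnegative integer and $H_i$ a graph for all $i$, such that $(n_{i},H_{i})\ne(n_{j},H_{j})$ for $i\neq j$ (the same graph may occur several times). Tutte symmetric function: for a graph $G$, $XB_G(t;x_1,x_2,\dots)=\sum_{\kappa}(1+t)^{e(\kappa)}\prod_{v\in V(G)}x_{\kappa(v)}\in\Lambda[t]$, where the sum is over all maps $\kappa:V(G)\to\{1,2,3,\dots\}$, $e(\kappa)$ is the number of edges of $G$ (with multiplicity; every loop is counted) whose endpoints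 receive the same value under $\kappa$, and $\Lambda[t]$ is the ring of polynomials in $t$ with coefficients in the algebra $\Lambda$ of symmetric functions over $\mathbb{C}$ in $x_1,x_2,\dots$. Extend $\mathbb{C}[t]$-linearly to $XB:\mathbb{G}[t]\to\Lambda[t]$, with kernel $Ker(XB)$. Extension: for a graph $G$ and a multiset $E$ of edges with endpoints in $V(G)$, $G\uplus E$ is the graph with vertex set $V(G)$ and edge multiset $E(G)\uplus E$ (multiplicities are added). For $L=\sum_{i} c_i(t)H_i$ with all $H_i$ graphs on $[n]$ and a graph $G$ on $[N]$, $N\ge n$, set $Ext(L;G)=\sum_i c_i(t)\,(G\uplus E(H_i))$. Modular relation: a linear combination $L\in\mathbb{G}[t]$ of graphs with vertex set $[n]$ is a modular relation for $XB$ if $Ext(L;G)\in Ker(XB)$ for every $N\ge n$ and every graph $G$ with vertex set $[N]$. *)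

(* Defs.v *)
From HB Require Import structures.
From mathcomp Require Import all_boot all_order all_algebra.
From mathcomp Require Import finmap multiset complex.
From mathcomp Require Import boolp classical_sets functions cardinality fsbigop.
From mathcomp Require Import reals.
From mathcomp Require Import monalg.

Set Implicit Arguments.
Unset Strict Implicit.
Unset Printing Implicit Defensive.

Import GRing.Theory.

Local Open Scope ring_scope.
Local Open Scope classical_set_scope.
Local Open Scope mset_scope.

(* The index sets {1, 2, ..., n} and {1, 2, ...} (vertices, and colours or
   variables) are represented by 'I_n and nat: the ordinal or natural number i
   stands for i + 1. *)

(* An unordered pair of not necessarily distinct vertices is the set of its
   elements; loops are the singletons. *)
Definition edge (n : nat) := {e : {set 'I_n} | (0 < #|e| <= 2)%N}.

Definition graph (n : nat) := {mset edge n}.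

(* All graphs with vertex set [n] for some n >= 1; the tag of a graph with
   n.+1 vertices is n. *)
Definition lgraph := {n : nat & graph n.+1}.

Definition Lgraph (n : nat) (H : graph n.+1) : lgraph :=
  Tagged (fun n => graph n.+1) H.

Definition num_edges (n : nat) (P : pred (edge n)) (H : graph n) : nat :=
  \sum_(e : edge n | P e) H e.

Definition mono_edges (n : nat) (H : graph n) (kappa : 'I_n -> nat) : nat :=
  num_edges [pred e : edge n |
    [forall u in val e, forall v in val e, kappa u == kappa v]] H.

Definition block_edges (n : nat) (H : graph n) (p : {set {set 'I_n}}) : nat :=
  num_edges [pred e : edge n | [exists B in p, val e \subset B]] H.

Section EdgeMap.
Context (m n : nat) (f : 'I_m -> 'I_n).

Fact edge_map_subproof (e : edge m) : (0 < #|f @: val e| <= 2)%N.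
Proof.
have /andP[e_gt0 e_le2] := valP e.
apply/andP; split; last exact: leq_trans (leq_imset_card _ _) e_le2.
case/card_gt0P: e_gt0 => x xe.
by apply/card_gt0P; exists (f x); rewrite imset_f.
Qed.

Definition edge_map (e : edge m) : edge n :=
  exist _ (f @: val e)%SET (edge_map_subproof e).

Definition graph_map (H : graph m) : graph n :=
  seq_mset [seq edge_map e | e <- (H : {mset edge m})].

End EdgeMap.

(* When tag H <= tag G, inord is the inclusion of the vertex set of H into that
   of G, and this is G with the edges of H added. It is not used otherwise. *)
Definition extend (H G : lgraph) : lgraph :=
  Lgraph (tagged G `+` graph_map (@inord (tag G)) (tagged H)).

Section Relations.
Context (R : realType).
Local Notation C := R[i].

Definition GT := {malg {poly C}[lgraph]}.

Definition Ext (L : GT) (G : lgraph) : GT :=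
  \sum_(H <- msupp L) << L@_H *g extend H G >>.

(* Formal power series over K in the variables x_1, x_2, ..., as coefficient
   functions on monomials. *)
Definition pseries (K : Type) := {cmonom nat} -> K.

Definition Lambda : set (pseries C) := [set f |
  (forall (s : nat -> nat) (m m' : {cmonom nat}), bijective s ->
     (forall i, m' (s i) = m i) -> f m' = f m) /\
  (exists d : nat, forall m : {cmonom nat}, (d < mdeg m)%N -> f m = 0)].

Definition Lambda_t : set (pseries {poly C}) := [set F |
  (exists d : nat, forall m, (size (F m) <= d)%N) /\
  (forall j : nat, Lambda (fun m => (F m)`_j))].

Definition colour_monomial (n : nat) (kappa : 'I_n -> nat) : {cmonom nat} :=
  \big[mmul/mone]_(v < n) ucm (kappa v).

(* The coefficient of the monomial m in the sum, over all maps kappa, of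
   (1+t)^e(kappa) times the product of the x_kappa(v). Only finitely many maps
   contribute to it by [finite_colourings] below, so that this finitely
   supported sum is the genuine one. *)
Definition XBG (G : lgraph) : pseries {poly C} := fun m =>
  \sum_(kappa \in [set kappa : {ffun 'I_(tag G).+1 -> nat} |
                     colour_monomial kappa = m])
     (1 + 'X : {poly C}) ^+ mono_edges (tagged G) kappa.

Definition XB (L : GT) : pseries {poly C} := fun m =>
  \sum_(G <- msupp L) L@_G * XBG G m.

Definition KerXB : set GT := [set L | XB L = fun=> 0].

Definition modular_relation (n : nat) (L : GT) : Prop :=
  (forall H : lgraph, H \in msupp L -> tag H = n) /\
  (forall G : lgraph, (n <= tag G)%N -> Ext L G \in KerXB).

Definition Tutte_standard_form (L : GT) (k : nat) (c : 'I_k -> C)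
    (e : 'I_k -> nat) (H : 'I_k -> lgraph) : Prop :=
  L = \sum_(i < k) << c i *: (1 + 'X) ^+ e i *g H i >> /\
  injective (fun i => (e i, H i)).

Definition B (n k : nat) (c : 'I_k -> C) (e : 'I_k -> nat)
    (H : 'I_k -> graph n) (p : {set {set 'I_n}}) : {poly C} :=
  \sum_(i < k) c i *: (1 + 'X) ^+ (e i + block_edges (H i) p).

End Relations.

Lemma colour_monomialE n (kappa : 'I_n -> nat) j :
  colour_monomial kappa j = (\sum_(v < n) (kappa v == j))%N.
Proof.
rewrite /colour_monomial; elim/big_rec2: _ => [|v a b _ <-]; first exact: cm1.
by rewrite cmM cmU.
Qed.

Lemma mdeg_colour_monomial n (kappa : 'I_n -> nat) :
  mdeg (colour_monomial kappa) = n.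
Proof.
rewrite /colour_monomial mdeg_prod.
under eq_bigr do rewrite mdegU.
by rewrite sum1_card card_ord.
Qed.

Lemma finite_colourings n (m : {cmonom nat}) :
  finite_set [set kappa : {ffun 'I_n -> nat} | colour_monomial kappa = m].
Proof.
pose F (f : {ffun 'I_n -> finsupp m}) := [ffun v => val (f v)].
apply: (@sub_finite_set _ _ (F @` setT)); last first.
  by apply: finite_image; exact: finite_finset.
move=> kappa /= km.
have ks v : kappa v \in finsupp m.
  by rewrite -cmE_neq0 -km colour_monomialE (bigD1 v) //= eqxx.
exists [ffun v => [` ks v]%fset] => //.
by apply/ffunP => v; rewrite !ffunE.
Qed.

Lemma XBG_sym (R : realType) (G : lgraph) (s : nat -> nat)
    (m m' : {cmonom nat}) :
  bijective s -> (forall i, m' (s i) = m i) -> XBG R G m' = XBG R G m.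
Proof.
move=> s_bij sm; have [s' sK s'K] := s_bij; have s_inj := can_inj sK.
rewrite /XBG.
rewrite (reindex_fsbig (fun kappa : {ffun 'I_(tag G).+1 -> nat} =>
    [ffun v => s (kappa v)]) [set kappa | colour_monomial kappa = m] [set kappa | colour_monomial kappa = m']); last first.
  split=> [kappa /= km|kappa1 kappa2 _ _ /ffunP eq_kappa|kappa /= km].
  - apply/eqP/cmP => j; rewrite -[j]s'K sm -km !colour_monomialE.
    by apply: eq_bigr => v _; rewrite ffunE (inj_eq s_inj).
  - by apply/ffunP => v; have := eq_kappa v; rewrite !ffunE => /s_inj.
  - exists [ffun v => s' (kappa v)]; last first.
      by apply/ffunP => v; rewrite !ffunE s'K.
    apply/eqP/cmP => j; rewrite -sm -km !colour_monomialE.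
    by apply: eq_bigr => v _; rewrite ffunE (can2_eq s'K sK).
apply: eq_fsbigr => kappa _; congr (_ ^+ _).
rewrite /mono_edges /num_edges; apply: eq_bigl => e /=.
apply: eq_forallb => u; congr (_ ==> _).
by apply: eq_forallb => v; rewrite !ffunE (inj_eq s_inj).
Qed.

Lemma XBG_degree (R : realType) (G : lgraph) (m : {cmonom nat}) :
  mdeg m != (tag G).+1 -> XBG R G m = 0.
Proof.
move=> dm; rewrite /XBG fsbig1 // => kappa /= km.
by move: dm; rewrite -km mdeg_colour_monomial eqxx.
Qed.

Lemma XBG_size (R : realType) (G : lgraph) (m : {cmonom nat}) :
  (size (XBG R G m) <= (num_edges predT (tagged G)).+1)%N.
Proof.
rewrite /XBG fsbig_finite //=; last exact: finite_colourings.
apply: leq_trans (size_sum _ _ _) _; apply/bigmax_leqP_seq => kappa _ _.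
rewrite addrC -['X + 1]/('X + 1%:P) -[X in X%:P]opprK polyCN size_exp_XsubC.
rewrite ltnS /mono_edges /num_edges big_mkcond /=.
by apply: leq_sum => e _; case: ifP.
Qed.

Lemma XB_Lambda_t (R : realType) (L : GT R) : XB L \in @Lambda_t R.
Proof.
have dL m : (\max_(G <- msupp L) (tag G).+1 < mdeg m)%N -> XB L m = 0.
  move=> ltm; rewrite /XB big_seq big1 // => G GL.
  rewrite XBG_degree ?mulr0 // neq_ltn (leq_ltn_trans _ ltm) ?orbT //.
  exact: (@leq_bigmax_seq _ _ _ (fun G : lgraph => (tag G).+1)).
pose E := (\max_(G <- msupp L)
  (size L@_G + (num_edges predT (tagged G)).+1))%N.
rewrite inE; split=> [|j].
  exists E => m /=; apply: leq_trans (size_sum _ _ _) _.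
  apply/bigmax_leqP_seq => G GL _; apply: leq_trans (size_polyMleq _ _) _.
  apply: leq_trans (leq_pred _) _.
  apply: leq_trans (@leq_bigmax_seq _ _ _ (fun G : lgraph =>
    size L@_G + (num_edges predT (tagged G)).+1)%N _ GL isT).
  by rewrite leq_add2l XBG_size.
split=> [s m m' s_bij sm|].
  suff -> : XB L m' = XB L m by [].
  apply: eq_bigr => G _; congr (_ * _).
  exact: XBG_sym s_bij sm.
exists (\max_(G <- msupp L) (tag G).+1)%N => m ltm.
by rewrite (dL _ ltm) coef0.
Qed.

(* Main.v *)
Require Import Defs.
From mathcomp Require Import finmap multiset monalg.
From mathcomp Require Import boolp classical_sets cardinality fsbigop.
From mathcomp Require Import all_boot all_order all_algebra.
From mathcomp Require Import complex reals.

(** Grouping the colourings of [G] by their restriction to the vertices of [L]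
    gives [XB (Ext L G) = \sum_kappa (1+t)^e_G(kappa) B(L; pi_kappa) x^kappa],
    where [pi_kappa] is the partition of [n] into colour classes; this yields
    sufficiency. Conversely, given a partition [p], let [G] carry [M] copies of
    every edge lying in a block of [p], and look at the coefficient of the
    monomial whose exponents are the block sizes of [p]. A colouring with this
    monomial which makes all edges of [G] monochromatic has exactly the blocks of
    [p] as colour classes, and all other colourings lose at least [M] edges. So
    for [M] large the degree in [t] of a nonzero [B(L; p)] could not cancel. *)

Set Implicit Arguments.
Unset Strict Implicit.
Unset Printing Implicit Defensive.

Import Order.TTheory GRing.Theory Num.Theory.

Local Open Scope ring_scope.

(** * Supports of formal linear combinations *)

Lemma msupp_sum_malg (K : choiceType) (A : zmodType) (I : eqType) (r : seq I)
    (a : I -> A) (h : I -> K) (x : K) :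
  x \in msupp (\sum_(i <- r) << a i *g h i >>) ->
  exists2 i, i \in r & h i = x.
Proof.
rewrite -mcoeff_neq0 raddf_sum /= => nz.
have [/hasP[i ir /eqP hi]|/hasPn noi] := boolP (has (fun i => h i == x) r).
  by exists i.
case/eqP: nz; rewrite big_seq big1 // => i ir.
by rewrite mcoeffU (negbTE (noi i ir)).
Qed.

(** The [h i] may repeat and coefficients may cancel, so [msupp L] need not be the list of the
    [h i]; the left side is first rewritten over that list without duplicates. *)
Lemma sum_msupp_malg (K : choiceType) (A : nzRingType) (I : eqType) (r : seq I)
    (a : I -> A) (h : I -> K) (f : K -> A) :
  let L : {malg A[K]} := \sum_(i <- r) << a i *g h i >> in
  \sum_(x <- msupp L) L@_x * f x = \sum_(i <- r) a i * f (h i).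
Proof.
move=> L.
have -> : \sum_(x <- msupp L) L@_x * f x =
    \sum_(x <- undup [seq h i | i <- r]) L@_x * f x.
  rewrite [RHS](bigID (fun x => x \in msupp L)) /= [X in _ + X]big1 ?addr0.
    rewrite -[RHS]big_filter; apply: perm_big; apply: uniq_perm => //.
      by rewrite filter_uniq ?undup_uniq.
    move=> x; rewrite mem_filter mem_undup andb_idr //.
    by case/msupp_sum_malg => i ir <-; rewrite map_f.
  by move=> x /mcoeff_outdom ->; rewrite mul0r.
under eq_bigr do rewrite raddf_sum mulr_suml.
rewrite exchange_big /=; apply: eq_big_seq => i ir.
rewrite (bigD1_seq (h i)) ?undup_uniq ?mem_undup ?map_f //= mcoeffUU.
rewrite big1 ?addr0 // => x; rewrite eq_sym => /negbTE hx.
by rewrite mcoeffU hx mul0r.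
Qed.

(** * Counting edges and monochromatic pairs *)

Lemma num_edges_count n (P : pred (edge n)) (H : graph n) :
  num_edges P H = count P (enum_mset H).
Proof.
rewrite -sum1_count (partition_big id P) //=; apply: eq_bigr => e Pe.
rewrite sum1_count -count_mem_mset; apply: eq_count => x /=.
by case: eqP => [->|]; rewrite ?Pe ?andbF.
Qed.

Lemma num_edgesD n (P : pred (edge n)) (G H : graph n) :
  num_edges P (msetD G H) = (num_edges P G + num_edges P H)%N.
Proof.
by rewrite /num_edges -big_split; apply: eq_bigr => e _; rewrite msetE2.
Qed.

Lemma num_edges_map m n (f : 'I_m -> 'I_n) (P : pred (edge n)) (H : graph m) :
  num_edges P (graph_map f H) = num_edges (P \o edge_map f) H.
Proof.
rewrite !num_edges_count (permP (perm_eq_seq_mset _)) count_map.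
by apply: eq_count.
Qed.

Lemma num_edges_le n (P : pred (edge n)) (H : graph n) :
  (num_edges P H <= num_edges predT H)%N.
Proof. by rewrite !num_edges_count count_predT count_size. Qed.

Lemma mono_edges_extend (H G : lgraph) (kappa : 'I_(tag G).+1 -> nat) :
  mono_edges (tagged (extend H G)) kappa =
  (mono_edges (tagged G) kappa +
     mono_edges (tagged H) (kappa \o @inord (tag G)))%N.
Proof.
rewrite /mono_edges num_edgesD num_edges_map; congr (_ + _)%N.
apply: eq_bigl => e /=.
apply/idP/idP => /forall_inP mono; apply/forall_inP.
  move=> u ue; apply/forall_inP => v ve.
  exact: (forall_inP (mono _ (imset_f _ ue)) _ (imset_f _ ve)).
move=> _ /imsetP[u ue ->]; apply/forall_inP => _ /imsetP[v ve ->].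
exact: (forall_inP (mono _ ue)).
Qed.

Lemma mono_edges_block n (H : graph n) (kappa : 'I_n -> nat) p :
    partition p [set: 'I_n] ->
    (forall u v, (v \in pblock p u) = (kappa u == kappa v)) ->
  mono_edges H kappa = block_edges H p.
Proof.
move=> /and3P[/eqP covp tip _] kp; apply: eq_bigl => e /=.
have inp u : u \in cover p by rewrite covp inE.
apply/forall_inP/exists_inP => [mono|[B Bp /subsetP eB] u ue].
  (* Edges are nonempty, so an endpoint [u] exists and its block is the witness. *)
  have /andP[/card_gt0P[u ue] _] := valP e.
  exists (pblock p u); first exact: pblock_mem.
  by apply/subsetP => v ve; rewrite kp (forall_inP (mono u ue)).
by apply/forall_inP => v ve; rewrite -kp (def_pblock tip Bp) ?eB.
Qed.

(* The number of monochromatic ordered pairs of vertices is the sum of the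
   squared exponents of the colour monomial. *)
Lemma colour_monomial_rigid n (kappa kappa' : 'I_n -> nat) :
    colour_monomial kappa = colour_monomial kappa' ->
    (forall u v, kappa' u = kappa' v -> kappa u = kappa v) ->
  forall u v, kappa u = kappa v -> kappa' u = kappa' v.
Proof.
move=> mm sub.
pose S (k : 'I_n -> nat) := [set w : 'I_n * 'I_n | k w.1 == k w.2]%SET.
pose V (k : 'I_n -> nat) := [seq k v | v <- enum 'I_n].
have cnt k j : count_mem j (V k) = colour_monomial k j.
  rewrite colour_monomialE count_map -sum1_count big_mkcond big_enum /=.
  by apply: eq_bigr => v _; case: (k v == j).
have pV : perm_eq (V kappa) (V kappa').
  by apply/allP => j _ /=; rewrite !cnt mm.
(* Each colour occurs in [V k] as often as its exponent, so this is the sum of the squared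
   exponents. *)
have cardS k : #|S k| = (\sum_(j <- V k) colour_monomial k j)%N.
  rewrite big_map big_enum /= -sum1dep_card big_mkcond.
  rewrite -(pair_bigA _ (fun u v => if k u == k v then 1 else 0)%N) /=.
  apply: eq_bigr => u _; rewrite colour_monomialE.
  by apply: eq_bigr => v _; rewrite eq_sym; case: (k v == k u).
have subS : S kappa' \subset S kappa.
  by apply/subsetP => w; rewrite !inE => /eqP /sub ->.
have /eqP eqS : S kappa' == S kappa.
  by rewrite eqEcard subS !cardS mm (perm_big _ pV) leqnn.
move=> u v uv; have : (u, v) \in S kappa' by rewrite eqS inE uv.
by rewrite inE => /eqP.
Qed.

(** * The test graph of a partition *)

Definition in_block n (p : {set {set 'I_n}}) : pred (edge n) :=
  [pred e : edge n | [exists B in p, val e \subset B]].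

Definition block_graph n (p : {set {set 'I_n}}) (M : nat) : graph n :=
  [fsfun e in [fset e in in_block p]%fset => M | 0%N].

Section BlockGraph.
Context (n M : nat) (p : {set {set 'I_n}}) (kappa : 'I_n -> nat).
Context (pP : partition p [set: 'I_n]).

Let tip : trivIset p. Proof. by case/and3P: pP. Qed.

Let inp u : u \in cover p.
Proof. by case/and3P: pP => /eqP -> _ _; rewrite inE. Qed.

Lemma block_graphE e : block_graph p M e = if in_block p e then M else 0%N.
Proof. by rewrite /block_graph fsfunE in_fset. Qed.

Lemma mono_edges_block_graph :
    (forall u v, v \in pblock p u -> kappa u = kappa v) ->
  mono_edges (block_graph p M) kappa = num_edges predT (block_graph p M).
Proof.
move=> kp; rewrite /mono_edges /num_edges big_mkcond; apply: eq_bigr => e _ /=.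
case: ifP => // /negP nmono; rewrite block_graphE; case: ifP => //.
case/exists_inP => B Bp /subsetP eB; case: nmono.
apply/forall_inP => u ue; apply/forall_inP => v ve; apply/eqP/kp.
by rewrite (def_pblock tip Bp) eB.
Qed.

(** The pair [u], [v] is an edge inside a block that is not monochromatic, so all its [M] copies are
    lost. *)
Lemma mono_edges_block_graph_lt u v :
    v \in pblock p u -> kappa u != kappa v ->
  (mono_edges (block_graph p M) kappa + M <=
     num_edges predT (block_graph p M))%N.
Proof.
move=> uv kuv.
have uv2 : (0 < #|[set u; v]%SET| <= 2)%N by rewrite cards2; case: (u != v).
pose e : edge n := exist (fun e : {set 'I_n} => 0 < #|e| <= 2)%N _ uv2.
rewrite /mono_edges /num_edges [X in (_ <= X)%N](bigID
  [pred e : edge n | [forall u in val e, forall v in val e,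
     kappa u == kappa v]]) /= leq_add2l.
rewrite (bigD1 e) /=; last first.
  apply: contra kuv => /forall_inP/(_ u); rewrite set21 => /(_ isT).
  by move=> /forall_inP/(_ v); rewrite set22 => /(_ isT).
rewrite block_graphE ifT ?leq_addr //.
apply/exists_inP; exists (pblock p u); first exact: pblock_mem.
by apply/subsetP => w /set2P[]->; rewrite ?mem_pblock.
Qed.

End BlockGraph.

(** * Expansion of [XB] on extensions *)

Section Relations.
Context (R : realType).
Local Notation C := R[i].

Lemma size_exp_1X k : size ((1 + 'X : {poly C}) ^+ k) = k.+1.
Proof.
by rewrite addrC -['X + 1]/('X + 1%:P) -[X in X%:P]opprK polyCN size_exp_XsubC.
Qed.

Context (n k : nat) (c : 'I_k -> C) (e : 'I_k -> nat).
Context (H : 'I_k -> graph n.+1).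

(** The polynomial [B] at the partition into colour classes of [kappa], written without forming that
    partition. *)
Definition Bcol (kappa : 'I_n.+1 -> nat) : {poly C} :=
  \sum_(i < k) c i *: (1 + 'X) ^+ (e i + mono_edges (H i) kappa).

Lemma Bcol_block (kappa : 'I_n.+1 -> nat) p :
    partition p [set: 'I_n.+1] ->
    (forall u v, (v \in pblock p u) = (kappa u == kappa v)) ->
  Bcol kappa = B c e H p.
Proof.
by move=> pP kp; apply: eq_bigr => i _; rewrite (mono_edges_block _ pP kp).
Qed.

(** A monochromatic edge of the extension comes from [G] or from [H i]; the power due to [G] is
    independent of [i] and factors out once the two sums are exchanged. *)
Lemma XB_Ext (G : lgraph) (m : {cmonom nat}) :
  let L : GT R := \sum_(i < k) << c i *: (1 + 'X) ^+ e i *g Lgraph (H i) >> in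
  XB (Ext L G) m =
  \sum_(kappa <- fset_set [set kappa : {ffun 'I_(tag G).+1 -> nat} |
                            colour_monomial kappa = m]%classic)
     (1 + 'X) ^+ mono_edges (tagged G) kappa *
     Bcol (fun v => kappa (inord v)).
Proof.
move=> L; rewrite /XB /Ext (@sum_msupp_malg _ _ _ _ _ _ (XBG R ^~ m)).
rewrite (@sum_msupp_malg _ _ _ _ _ _ (fun H => XBG R (extend H G) m)) /=.
have XBE (i : 'I_k) := fsbig_finite +%R
  (fun kappa : {ffun 'I_(tag G).+1 -> nat} => (1 + 'X : {poly C}) ^+
     mono_edges (tagged (extend (Lgraph (H i)) G)) kappa)
  (@finite_colourings (tag G).+1 m).
under eq_bigr => i _ do rewrite /XBG XBE mulr_sumr.
rewrite exchange_big; apply: eq_bigr => kappa _; rewrite mulr_sumr.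
apply: eq_bigr => i _; rewrite mono_edges_extend !exprD -!scalerAl -scalerAr.
by congr (_ *: _); rewrite mulrCA.
Qed.

(** Uniformity in [kappa] allows the multiplicity in the test graph to be fixed before any colouring
    is chosen. *)
Lemma size_Bcol : exists D, forall kappa, (size (Bcol kappa) <= D)%N.
Proof.
exists (\max_(i < k) (e i + num_edges predT (H i)).+1) => kappa.
apply: leq_trans (size_sum _ _ _) _; apply/bigmax_leqP => i _.
apply: leq_trans (size_scale_leq _ _) _; rewrite size_exp_1X.
apply: leq_trans (leq_bigmax i).
by rewrite ltnS leq_add2l num_edges_le.
Qed.

End Relations.

Theorem theorem4 (R : realType) (n k : nat) (c : 'I_k -> R[i])
    (e : 'I_k -> nat) (H : 'I_k -> graph n.+1) (L : GT R) :
  Tutte_standard_form L c e (fun i => Lgraph (H i)) ->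
  modular_relation n L <->
  (forall p : {set {set 'I_n.+1}}, partition p [set: 'I_n.+1] ->
     B c e H p = 0).
Proof.
case=> -> _; split=> [[_ modL] p pP|B0]; last first.
  split=> [G /msupp_sum_malg[i _ <-] //|G _].
  apply/mem_set/funext => m; rewrite XB_Ext big1 // => kappa _.
  pose kap (v : 'I_n.+1) := kappa (inord v).
  have eqP : {in [set: 'I_n.+1] & &, equivalence_rel [rel u v | kap u == kap v]}.
    by move=> u v w _ _ _ /=; split=> // /eqP ->.
  rewrite (@Bcol_block _ _ _ _ _ _ kap _ (equivalence_partitionP eqP)) ?B0 ?mulr0 //.
    exact: equivalence_partitionP.
  by move=> u v; rewrite (pblock_equivalence_partition eqP) ?inE.
have [_ tip _] := and3P pP; have inp u : u \in cover p.
  by case/and3P: pP => /eqP -> _ _; rewrite inE.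
have [D sizeD] := size_Bcol c e H.
pose G := block_graph p D; pose T := num_edges predT G.
(* Distinct blocks get distinct colours, namely their ranks among all vertex sets. *)
pose kp : {ffun 'I_n.+1 -> nat} := [ffun v => enum_rank (pblock p v) : nat].
have kpE u v : (kp u == kp v) = (v \in pblock p u).
  by rewrite !ffunE (inj_eq val_inj) (inj_eq enum_rank_inj) eq_pblock.
pose S := fset_set [set kappa : {ffun 'I_n.+1 -> nat} |
                     colour_monomial kappa = colour_monomial kp]%classic.
have inS kappa : kappa \in S -> colour_monomial kappa = colour_monomial kp.
  by rewrite in_fset_set ?in_setE //; exact: finite_colourings.
have kpS : kp \in S.
  by rewrite in_fset_set ?in_setE //; exact: finite_colourings.
pose coarse (kappa : {ffun 'I_n.+1 -> nat}) :=
  [forall u, forall v, (v \in pblock p u) ==> (kappa u == kappa v)].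
have /(congr1 (fun F => F (colour_monomial kp))) :=
  set_mem (modL (Lgraph G) (leqnn n)).
rewrite XB_Ext -/S /= (bigID coarse) /=.
(* By rigidity each coarse colouring in [S] has exactly the blocks of [p] as classes, so all of them
   contribute the same term. *)
have -> : \sum_(kappa <- S | coarse kappa) (1 + 'X) ^+ mono_edges G kappa *
      Bcol c e H (fun v => kappa (inord v)) =
    ((1 + 'X) ^+ T * B c e H p) *+ count coarse S.
  rewrite -iter_addr_0 -big_const_seq big_seq_cond [RHS]big_seq_cond.
  apply: eq_bigr => kappa /andP[/inS kS /forallP co].
  have {}co u v : v \in pblock p u -> kappa u = kappa v.
    by move=> uv; have /forallP/(_ v)/implyP/(_ uv)/eqP := co u.
  rewrite mono_edges_block_graph //; congr (_ * _); apply: Bcol_block => // u v.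
  rewrite !inord_val -kpE; apply/eqP/eqP; last first.
    apply: (colour_monomial_rigid kS) => u' v' /eqP; rewrite kpE; exact: co.
  by move=> /eqP; rewrite kpE; exact: co.
set rest := (X in _ + X) => /eqP; rewrite addr_eq0 => /eqP sum0.
(* A colouring that splits a block has at most [T - D] monochromatic edges, and multiplying by
   [Bcol] adds at most [D] to that exponent in the size. *)
have size_rest : (size (- rest) <= T)%N.
  rewrite size_polyN; apply: leq_trans (size_sum _ _ _) _.
  apply/bigmax_leqP_seq => kappa _ /forallPn[u /forallPn[v]].
  rewrite negb_imply => /andP[uv kuv].
  have := mono_edges_block_graph_lt D pP uv kuv; apply: leq_trans.
  apply: leq_trans (size_polyMleq _ _) _.
  by rewrite size_exp_1X /= leq_add2l sizeD.
apply/eqP/negPn/negP => Bn0; move: size_rest; rewrite -sum0.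
(* The colouring [kp] is itself coarse, so in characteristic zero the main term, for nonzero [B],
   has size [T] plus the size of [B], exceeding [T]. *)
have cnt0 : (count coarse S)%:R != 0 :> R[i].
  rewrite pnatr_eq0 -lt0n -has_count; apply/hasP; exists kp => //.
  apply/forallP => u; apply/forallP => v; apply/implyP; by rewrite kpE.
rewrite -scaler_nat size_scale // size_mul //; last first.
  by rewrite -size_poly_eq0 size_exp_1X.
rewrite size_exp_1X addSn /= -[X in (_ <= X)%N]addn0 leq_add2l leqn0.
by rewrite size_poly_eq0 (negbTE Bn0).
Qed.
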